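(* Let $(\mathfrak{A}, \mathbb{Z}, \Theta)$ be a C*-dynamical system, and let $a \in \mathfrak{A}$ be a positive element. Then $\Gamma(a) = m\left(a \vert \mathcal{S}^{\mathbb{Z}}\right)$.
   Context: A C*-dynamical system $(\mathfrak{A}, \mathbb{Z}, \Theta)$ consists of a unital C*-algebra $\mathfrak{A}$ and an action $\Theta$ of $\mathbb{Z}$ on $\mathfrak{A}$ by *-automorphisms. $\mathcal{S}^{\mathbb{Z}}$ denotes the set of $\Theta$-invariant states of $\mathfrak{A}$, i.e. states $\phi$ with $\phi \circ \Theta_j = \phi$ for all $j \in \mathbb{Z}$. For self-adjoint $x$ and compact convex $K \subseteq \mathcal{S}^{\mathbb{Z}}$ (weak*-topology), $m(x \vert K) = \sup_{\psi \in K} \psi(x)$. For positive $a \in \mathfrak{A}$ the gauge of $a$ is $\Gamma(a) = \lim_{k \to \infty} \frac{1}{k} \left\| \sum_{j=0}^{k-1} \Theta_j a \right\|$ (the limit exists by subadditivity). *)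

(* Defs.v *)
From HB Require Import structures.
From mathcomp Require Import all_boot all_order all_algebra.
From mathcomp Require Import all_classical all_reals all_analysis.
From mathcomp Require Export complex.
Set Implicit Arguments.
Unset Strict Implicit.
Unset Printing Implicit Defensive.
Import Order.TTheory GRing.Theory Num.Theory.
Import numFieldNormedType.Exports.
Local Open Scope classical_set_scope.
Local Open Scope ring_scope.

(* Unital C*-algebras over [R[i]].  The norm is a real-valued field of the
   mixin, with completeness stated by Cauchy sequences: [normedModType R[i]]
   has an [R[i]]-valued norm, and it has no join with [algType] in the library
   hierarchy.  An [algType] satisfies [1 != 0], so [cnorm 1 = 1] follows from
   the C*-identity; nonnegativity of [cnorm] follows from the triangle
   inequality and homogeneity. *)
HB.mixin Record isCStarAlgebra (R : realType) A of GRing.Algebra R[i] A := {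
  star : A -> A;
  cnorm : A -> R;
  starK : involutive star;
  starD : {morph star : x y / x + y};
  starZ : forall (k : R[i]) (x : A), star (k *: x) = conjc k *: star x;
  starM : forall x y : A, star (x * y) = star y * star x;
  cnorm_eq0 : forall x : A, cnorm x = 0 -> x = 0;
  cnormD_le : forall x y : A, cnorm (x + y) <= cnorm x + cnorm y;
  cnormZ : forall (k : R[i]) (x : A),
    (cnorm (k *: x))%:C%C = `|k| * (cnorm x)%:C%C;
  cnormM_le : forall x y : A, cnorm (x * y) <= cnorm x * cnorm y;
  cnorm_starM : forall x : A, cnorm (star x * x) = cnorm x ^+ 2;
  cnorm_complete : forall u : nat -> A,
    (forall e : R, 0 < e -> exists N : nat,
       forall m n, (N <= m)%N -> (N <= n)%N -> cnorm (u m - u n) < e) ->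
    exists l : A, (fun n => cnorm (u n - l)) @ \oo --> (0 : R)
}.

#[short(type="cstarAlgType")]
HB.structure Definition CStarAlgebra (R : realType) :=
  {A of isCStarAlgebra R A & GRing.Algebra R[i] A}.

Section CStarDynamics.
Context (R : realType) (A : cstarAlgType R).

Definition self_adjoint (x : A) : Prop := star x = x.

Definition invertible (x : A) : Prop := exists y : A, x * y = 1 /\ y * x = 1.

Definition spectrum (x : A) : set R[i] :=
  [set z | ~ invertible (x - z%:A)].

(* [0 <= z] in [R[i]] means that [z] is real and nonnegative. *)
Definition positive (x : A) : Prop :=
  self_adjoint x /\ spectrum x `<=` [set z | 0 <= z].

Definition state (phi : {scalar A}) : Prop :=
  (forall x : A, positive x -> 0 <= phi x) /\ phi 1 = 1.

(* Bijectivity of each [theta j] follows from [theta0] and [thetaD]. *)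
Record z_action := ZAction {
  theta :> int -> {lrmorphism A -> A};
  theta_star : forall j x, theta j (star x) = star (theta j x);
  theta0 : forall x, theta 0 x = x;
  thetaD : forall i j x, theta (i + j) x = theta i (theta j x)
}.

Definition invariant_states (Theta : z_action) : set {scalar A} :=
  [set phi | state phi /\ forall j x, phi (Theta j x) = phi x].

(* To be used with [x] self-adjoint and [K] a set of states: then every [psi x]
   is real and [Re] loses nothing. *)
Definition max_value (x : A) (K : set {scalar A}) : \bar R :=
  ereal_sup [set (complex.Re (psi x))%:E | psi in K].

Definition gauge_seq (Theta : z_action) (a : A) : R^nat :=
  fun k => k%:R^-1 * cnorm (\sum_(0 <= j < k) Theta j%:Z a).

Definition gauge (Theta : z_action) (a : A) : R := lim (gauge_seq Theta a @ \oo).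

End CStarDynamics.

(* Main.v *)
Require Import Defs.
From HB Require Import structures.
From mathcomp Require Import all_boot all_order all_algebra.
From mathcomp Require Import all_classical all_reals all_analysis.
From mathcomp Require Import ring lra.
Set Implicit Arguments.
Unset Strict Implicit.
Unset Printing Implicit Defensive.
Import Order.TTheory GRing.Theory Num.Theory.
Import numFieldNormedType.Exports.

(** Write [S k x] for the orbit sum of [Theta j x] over [0 <= j < k].

    An invariant state [phi] satisfies [phi (S k a) = k * phi a], and
    [phi y <= cnorm y] for self-adjoint [y] because [cnorm y - y] is positive.
    Hence [phi a <= cnorm (S k a) / k] for all [k > 0], and [phi a] is at most
    the gauge, which is the infimum of these quotients by subadditivity
    ([gauge_cvg]).

    Conversely, an invariant state with value at least the gauge at [a] comes
    directly out of Hahn-Banach ([hahn_banach]), without weak-* compactness.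
    Consider on [A], as a real vector space, the functional
      [upper_mean x = inf (cnorm (t + S k x) - t) / k]
    over [k > 0] and [t >= 0].  It is sublinear.  The variable [t] makes it see
    upper bounds only, and a real linear functional [f <= upper_mean] is
    automatically normalised, nonnegative on positive elements, zero on [i * y]
    for self-adjoint [y], and invariant: [S k (Theta 1 x - x)] telescopes, so
    it is bounded in [k] and its mean tends to [0].  Thus
    [phi x = f x - i * f (i * x)] is an invariant state.  Choosing
    [f a = upper_mean a] gives [phi a >= gauge a], since [S k a] is positive
    and [cnorm (t + y) = t + cnorm y] for positive [y].

    Besides the reality of the spectrum of self-adjoint elements, the spectral
    theory needed reduces to one fact ([norm_in_spectrum]): a self-adjoint [y]
    has [cnorm y] or [- cnorm y] in its spectrum.  No
    complex analysis is involved.  If both were absent, [m^2 - y^2] with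
    [m = cnorm y] would be invertible, and so would have a little room below
    it: [m^2 - d - y^2 = h^2] for some [d > 0] and some self-adjoint [h]
    commuting with [y].  Then [cnorm (y + i h)^2 = cnorm (y^2 + h^2) = m^2 - d]
    by the C*-identity, whereas [cnorm y <= cnorm (y + i h)].  Inverses and
    square roots of elements close to [1] are fixed points of contractions. *)

(** * The Hahn-Banach theorem for sublinear functionals *)

Section HahnBanach.
Local Open Scope classical_set_scope.
Local Open Scope ring_scope.
Context (R : realType) (V : lmodType R).
Implicit Types (p q : V -> R) (x y z : V).

Definition sublinear p : Prop :=
  (forall x y, p (x + y) <= p x + p y) /\
  (forall (r : R) x, 0 < r -> p (r *: x) <= r * p x).

Lemma sublinearZ p (r : R) x : sublinear p -> 0 < r -> p (r *: x) = r * p x.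
Proof.
move=> [_ pZ] r0; apply/le_anti; rewrite pZ//=.
have := pZ r^-1 (r *: x); rewrite invr_gt0 => /(_ r0).
by rewrite scalerA mulVf ?gt_eqF// scale1r ler_pdivlMl.
Qed.

Lemma sublinear0 p : sublinear p -> p 0 = 0.
Proof.
move=> sp; have := sublinearZ 0 sp (ltr0n R 2 : 0 < 2).
by rewrite scaler0; lra.
Qed.

Lemma sublinearN p x : sublinear p -> - p (- x) <= p x.
Proof.
move=> sp; have := sp.1 x (- x).
by rewrite subrr (sublinear0 sp); lra.
Qed.

Lemma le_infD (S T : set R) (c : R) : S !=set0 -> T !=set0 ->
  (forall s t, S s -> T t -> c <= s + t) -> c <= inf S + inf T.
Proof.
move=> S0 T0 le; rewrite -lerBlDr; apply: lb_le_inf => // s Ss.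
rewrite lerBlDr -lerBlDl; apply: lb_le_inf => // t Tt.
by rewrite lerBlDl le.
Qed.

(** The common source of sublinearity for the three infima used below: the
    lowering of a functional along a vector, the infimum of a chain, and the
    upper mean. *)
Lemma sublinear_inf (E : V -> set R) :
  (forall x, E x !=set0) -> (forall x, has_lbound (E x)) ->
  (forall x y s t, E x s -> E y t -> exists2 u, E (x + y) u & u <= s + t) ->
  (forall (r : R) x s, 0 < r -> E x s ->
    exists2 u, E (r *: x) u & u <= r * s) ->
  sublinear (fun x => inf (E x)).
Proof.
move=> E0 Elb ED EZ; split=> [x y|r x r0].
  apply: le_infD => // s t Es Et; have [u Eu ust] := ED _ _ _ _ Es Et.
  exact: le_trans (ge_inf _ Eu) ust.
rewrite -ler_pdivrMl//; apply: lb_le_inf => // s Es.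
have [u Eu us] := EZ _ _ _ r0 Es.
by rewrite ler_pdivrMl//; exact: le_trans (ge_inf _ Eu) us.
Qed.

(** The largest sublinear functional below [p] with value at most [- p z] at
    [- z]: lowering [p] in this way forces linearity on the line through [z]. *)
Definition lowered p z x : R :=
  inf [set p (x + s *: z) - s * p z | s in [set s : R | 0 <= s]].

Lemma lowered_has_lbound p z x : sublinear p ->
  has_lbound [set p (x + s *: z) - s * p z | s in [set s : R | 0 <= s]].
Proof.
move=> sp; exists (- p (- x)) => _ [s /= s0 <-].
have := sp.1 (x + s *: z) (- x); rewrite addrAC subrr add0r.
have [<-|sN0] := eqVneq 0 s.
  by rewrite scale0r (sublinear0 sp) addr0; lra.
by rewrite sublinearZ// ?lt_def 1?eq_sym ?sN0//; lra.
Qed.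

Lemma sublinear_lowered p z : sublinear p -> sublinear (lowered p z).
Proof.
move=> sp; apply: sublinear_inf.
- by move=> x; exists (p (x + 0 *: z) - 0 * p z); exists 0 => /=.
- by move=> x; exact: lowered_has_lbound.
- move=> x y _ _ [s /= s0 <-] [t /= t0 <-].
  exists (p (x + y + (s + t) *: z) - (s + t) * p z).
    by exists (s + t) => //=; rewrite addr_ge0.
  have := sp.1 (x + s *: z) (y + t *: z).
  by rewrite addrACA -scalerDl; lra.
- move=> r x _ r0 [s /= s0 <-].
  exists (p (r *: x + (r * s) *: z) - (r * s) * p z).
    by exists (r * s) => //=; rewrite mulr_ge0// ltW.
  by rewrite -scalerA -scalerDr sublinearZ//; lra.
Qed.

Lemma lowered_le p z x : sublinear p -> lowered p z x <= p x.
Proof.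
move=> sp; apply: ge_inf; first exact: lowered_has_lbound.
by exists 0 => //=; rewrite scale0r addr0 mul0r subr0.
Qed.

Lemma loweredN_le p z : sublinear p -> lowered p z (- z) <= - p z.
Proof.
move=> sp; apply: ge_inf; first exact: lowered_has_lbound.
by exists 1 => //=; rewrite scale1r addNr (sublinear0 sp) mul1r add0r.
Qed.

(** Zorn's lemma applies because a sublinear [q <= p] satisfies
    [q x >= - p (- x)], so that the pointwise infimum of a chain is finite. *)
Lemma sublinear_minimal p : sublinear p -> exists2 q,
  sublinear q /\ (forall x, q x <= p x) &
  forall q', sublinear q' -> (forall x, q' x <= q x) -> forall x, q' x = q x.
Proof.
move=> sp.
pose T := {q : V -> R | sublinear q /\ forall x, q x <= p x}.
pose le_T (s t : T) := `[< forall x, sval t x <= sval s x >].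
pose p_T : T := exist _ p (conj sp (fun=> lexx _)).
have [|r s t /asboolP rs /asboolP st||[q [sq qp]] qmin] :=
    @ZL_preorder T p_T le_T.
- by move=> t; apply/asboolP.
- by apply/asboolP => x; exact: le_trans (st x) (rs x).
- move=> S Stot; have [[t0 St0]|S0] := pselect (exists t, S t); last first.
    by exists p_T => s Ss; exfalso; apply: S0; exists s.
  have lbS x : has_lbound [set sval t x | t in S].
    exists (- p (- x)) => _ [t St <-]; case: (svalP t) => sub_t le_t.
    by apply: le_trans (sublinearN x sub_t); rewrite lerN2.
  have sinf : sublinear (fun x => inf [set sval t x | t in S]).
    apply: sublinear_inf => //.
    + by move=> x; exists (sval t0 x); exists t0.
    + move=> x y _ _ [t1 S1 <-] [t2 S2 <-].
      have [/asboolP le12|/asboolP le21] := Stot _ _ S1 S2.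
      * exists (sval t2 (x + y)); first by exists t2.
        by apply: le_trans ((svalP t2).1.1 x y) _; rewrite lerD2r.
      * exists (sval t1 (x + y)); first by exists t1.
        by apply: le_trans ((svalP t1).1.1 x y) _; rewrite lerD2l.
    + move=> r x _ r0 [t St <-]; exists (sval t (r *: x)); first by exists t.
      exact: (svalP t).1.2.
  have infp x : inf [set sval t x | t in S] <= p x.
    apply: le_trans (ge_inf (lbS x) _) ((svalP t0).2 x).
    by exists t0.
  pose t : T := exist _ (fun x => inf [set sval t x | t in S]) (conj sinf infp).
  exists t => s Ss; apply/asboolP => x /=.
  by apply: ge_inf => //; exists s.
exists q => // q' sq' q'q x; apply/le_anti; rewrite q'q/=.
have q'p y : q' y <= p y by exact: le_trans (q'q y) (qp y).
pose t : T := exist _ q' (conj sq' q'p).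
by have /asboolP := qmin t (asboolT q'q); apply.
Qed.

(** A minimal sublinear functional is linear: lowering it along any [x] cannot
    change it, whence [q (- x) <= - q x].  Starting from [p] lowered along [z]
    makes the minimal functional reach the value [p z]. *)
Lemma hahn_banach p z : sublinear p ->
  exists2 f : {scalar V}, (forall x, f x <= p x) & f z = p z.
Proof.
move=> sp; have sl := sublinear_lowered z sp.
have [q [sq ql] qmin] := sublinear_minimal sl.
have qN x : q (- x) = - q x.
  apply/le_anti/andP; split; last first.
    by have := sublinearN (- x) sq; rewrite opprK; lra.
  rewrite -(qmin _ (sublinear_lowered x sq)); first exact: loweredN_le.
  by move=> y; exact: lowered_le.
have qD x y : q (x + y) = q x + q y.
  apply/le_anti; rewrite sq.1/=.
  by have := sq.1 (x + y) (- y); rewrite addrK qN; lra.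
have qZ r x : q (r *: x) = r * q x.
  have [r0|r0|<-] := ltgtP 0 r.
  - exact: sublinearZ.
  - rewrite -[r]opprK scaleNr qN sublinearZ ?oppr_gt0//; lra.
  - by rewrite scale0r mul0r sublinear0.
have q_scalar : scalar q by move=> r x y; rewrite qD qZ.
pose f : {scalar V} := HB.pack q (GRing.isLinear.Build _ _ _ _ q q_scalar).
have qp x : q x <= p x by exact: le_trans (ql x) (lowered_le _ _ sp).
exists f => //=; apply/le_anti; rewrite qp/=.
have := le_trans (ql (- z)) (loweredN_le z sp).
by rewrite qN lerN2.
Qed.

End HahnBanach.

(** * Complex functionals from real ones *)

Section RestrictScalars.
Local Open Scope ring_scope.
Context (R : realType).

(** A type synonym, so that the real and the complex module structures on the
    same carrier do not compete during inference. *)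
Definition restrict_scalars (V : lmodType R[i]) : Type := V.

HB.instance Definition _ (V : lmodType R[i]) :=
  GRing.Zmodule.on (restrict_scalars V).

Section Module.
Context (V : lmodType R[i]).

Let scale_real (r : R) (x : restrict_scalars V) : restrict_scalars V :=
  (r%:C)%C *: (x : V).

Let scale_realA r s x : scale_real r (scale_real s x) = scale_real (r * s) x.
Proof. by rewrite /scale_real scalerA -rmorphM. Qed.

Let scale_real1 : left_id 1 scale_real.
Proof. by move=> x; rewrite /scale_real scale1r. Qed.

Let scale_realDr : right_distributive scale_real +%R.
Proof. by move=> r x y; rewrite /scale_real scalerDr. Qed.

Let scale_realDl x : {morph scale_real^~ x : r s / r + s}.
Proof. by move=> r s; rewrite /scale_real rmorphD scalerDl. Qed.

HB.instance Definition _ := GRing.Zmodule_isLmodule.Build R (restrict_scalars V)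
  scale_realA scale_real1 scale_realDr scale_realDl.

Lemma complexify (f : {scalar restrict_scalars V}) :
  exists phi : {scalar V}, forall x : V, phi x = (f x -i* f ('i%C *: x))%C.
Proof.
pose g (x : V) := (f x -i* f ('i%C *: x))%C.
have gP : scalar g.
  move=> [a b] x y; rewrite /g.
  have fD (u v : V) : f (u + v : V) = f u + f v := raddfD f u v.
  have fZ (r : R) (u : V) : f ((r%:C)%C *: u : V) = r * f u := linearZ_LR f r u.
  have zE : Complex a b = (a%:C)%C + (b%:C)%C * 'i%C :> R[i].
    by simpc.
  have izE : 'i%C * Complex a b = (a%:C)%C * 'i%C + ((- b)%:C)%C :> R[i].
    by simpc.
  rewrite scalerDr scalerA !fD izE zE !scalerDl -!scalerA !fD !fZ.
  by apply/eqP; rewrite eq_complex /=; apply/andP; split; apply/eqP; ring.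
pose phi : {scalar V} := HB.pack g (GRing.isLinear.Build _ _ _ _ g gP).
by exists phi.
Qed.

End Module.
End RestrictScalars.

Section CStarAlgebra.
Local Open Scope classical_set_scope.
Local Open Scope ring_scope.
Context (R : realType) (A : cstarAlgType R).
Implicit Types (r s t : R) (x y z : A).

Local Notation "r *r x" := ((r%:C)%C *: x) (at level 40).
Local Notation "r %:S" := ((r%:C)%C *: (1 : A))
  (at level 2, format "r %:S").

(** * Norm and involution *)

Lemma star0 : star (0 : A) = 0.
Proof. by apply: (addrI (star (0 : A))); rewrite -starD !addr0. Qed.

Lemma starN x : star (- x) = - star x.
Proof. by apply: (addrI (star x)); rewrite -starD !subrr star0. Qed.

Lemma star1 : star (1 : A) = 1.
Proof. by rewrite -[LHS]mulr1 -{2}[1]starK -starM mulr1 starK. Qed.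

Lemma star_rscale r x : star (r *r x) = r *r star x.
Proof. by rewrite starZ conjc_real. Qed.

Lemma star_rscalar r : star (r%:S) = r%:S.
Proof. by rewrite star_rscale star1. Qed.

Lemma rscalarD r s : (r + s)%:S = r%:S + s%:S.
Proof. by rewrite rmorphD scalerDl. Qed.

Lemma rscalarB r s : (r - s)%:S = r%:S - s%:S.
Proof. by rewrite rmorphB scalerBl. Qed.

Lemma rscalar_mull r x : r%:S * x = r *r x.
Proof. by rewrite -scalerAl mul1r. Qed.

Lemma rscalar_mulr r x : x * r%:S = r *r x.
Proof. by rewrite -scalerAr mulr1. Qed.

Lemma rscalarM r s : (r * s)%:S = r%:S * s%:S.
Proof. by rewrite rscalar_mull rmorphM scalerA. Qed.

Lemma normc_real r : `|(r%:C)%C| = (`|r|%:C)%C :> R[i].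
Proof. by rewrite normc_def /= expr0n addr0 sqrtr_sqr. Qed.

Lemma cnorm_rscale r x : cnorm (r *r x) = `|r| * cnorm x.
Proof.
by apply: (@complexI R); rewrite cnormZ normc_real rmorphM.
Qed.

Lemma cnormN x : cnorm (- x) = cnorm x.
Proof.
have -> : - x = (-1) *r x by rewrite rmorphN1 scaleN1r.
by rewrite cnorm_rscale normrN1 mul1r.
Qed.

Lemma cnorm0 : cnorm (0 : A) = 0.
Proof. by rewrite -(scaler0 A (0%:C)%C) cnorm_rscale normr0 mul0r. Qed.

Lemma cnorm_ge0 x : 0 <= cnorm x.
Proof. by have := cnormD_le x (- x); rewrite subrr cnorm0 cnormN; lra. Qed.

Lemma cnorm_distC x y : cnorm (x - y) = cnorm (y - x).
Proof. by rewrite -cnormN opprB. Qed.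

Lemma cnorm1 : cnorm (1 : A) = 1.
Proof.
have := cnorm_starM (1 : A); rewrite star1 mulr1 => e.
have n0 : cnorm (1 : A) != 0.
  by apply/eqP => /cnorm_eq0 /eqP; rewrite oner_eq0.
by apply: (mulfI n0); rewrite mulr1 [RHS]e expr2.
Qed.

Lemma cnorm_rscalar r : cnorm (r%:S) = `|r|.
Proof. by rewrite cnorm_rscale cnorm1 mulr1. Qed.

Lemma cnorm_star x : cnorm (star x) = cnorm x.
Proof.
suff le y : cnorm y <= cnorm (star y).
  by apply/le_anti; rewrite le andbT; have := le (star x); rewrite starK.
have [y0|yN0] := eqVneq (cnorm y) 0; first by rewrite y0 cnorm_ge0.
have y0 : 0 < cnorm y by rewrite lt_def yN0 cnorm_ge0.
rewrite -(ler_pM2r y0) -expr2 -cnorm_starM.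
exact: cnormM_le.
Qed.

Lemma cnorm_sqr x : self_adjoint x -> cnorm (x * x) = cnorm x ^+ 2.
Proof. by move=> xs; rewrite -cnorm_starM xs. Qed.

Lemma cnorm_dist_tri x y z : cnorm (x - z) <= cnorm (x - y) + cnorm (y - z).
Proof. by have := cnormD_le (x - y) (y - z); rewrite addrA subrK. Qed.

Lemma cnorm_le_eq0 r x : r < 1 -> cnorm x <= r * cnorm x -> x = 0.
Proof.
by move=> r1 le; apply: cnorm_eq0; have := cnorm_ge0 x; nra.
Qed.

(** * Fixed points and inverses near the identity *)

(** Banach's fixed point theorem on the ball of radius [M].  Applying the
    contraction [N] times to two points of the orbit of [0] brings them within
    [r ^+ N * (M + M)], which is the Cauchy property. *)
Lemma fixed_point (F : A -> A) (M r : R) : 0 <= M -> 0 <= r < 1 ->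
  (forall x, cnorm x <= M -> cnorm (F x) <= M) ->
  (forall x y, cnorm x <= M -> cnorm y <= M ->
    cnorm (F x - F y) <= r * cnorm (x - y)) ->
  exists2 l, cnorm l <= M & F l = l.
Proof.
move=> M0 /andP[r0 r1] FM Fr.
pose u n := iter n F 0.
have uM n : cnorm (u n) <= M.
  by elim: n => [|n IHn] /=; [rewrite cnorm0|exact: FM].
have uD N m n : cnorm (u (N + m)%N - u (N + n)%N) <= r ^+ N * (M + M).
  elim: N => [|N IHN].
    rewrite !add0n expr0 mul1r; apply: le_trans (cnormD_le _ _) _.
    by rewrite cnormN lerD.
  rewrite !addSn exprS -mulrA; apply: le_trans (Fr _ _ (uM _) (uM _)) _.
  exact: ler_wpM2l.
have rcvg : (fun n => r ^+ n * (M + M)) @ \oo --> (0 : R).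
  rewrite -[X in _ --> X](mul0r (M + M)); apply: cvgMl.
  by apply: cvg_expr; rewrite ger0_norm.
have rsmall (e : R) : 0 < e -> exists N : nat, r ^+ N * (M + M) < e.
  move=> e0; have /cvgrPdist_lt /(_ _ e0) [N _ H] := rcvg.
  exists N; have := H N (leqnn N); rewrite /= sub0r normrN ger0_norm//.
  by rewrite mulr_ge0 ?exprn_ge0 ?addr_ge0.
have [e e0|l ul] := cnorm_complete u.
  have [N rN] := rsmall e e0; exists N => m n Nm Nn.
  by rewrite -(subnKC Nm) -(subnKC Nn); exact: le_lt_trans (uD _ _ _) rN.
have lim0 (e : R) : 0 < e ->
    exists n, cnorm (u n - l) < e /\ cnorm (u n.+1 - l) < e.
  move=> e0; have /cvgrPdist_lt /(_ _ e0) [N _ H] := ul; exists N; split.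
  - by have := H N (leqnn N); rewrite /= sub0r normrN ger0_norm ?cnorm_ge0.
  - by have := H N.+1 (leqnSn N); rewrite /= sub0r normrN ger0_norm ?cnorm_ge0.
have lM : cnorm l <= M.
  rewrite leNgt; apply/negP => Ml.
  have [|n [un _]] := lim0 (cnorm l - M); first by rewrite subr_gt0.
  have := cnormD_le (l - u n) (u n); rewrite subrK cnorm_distC.
  by have := uM n; lra.
exists l => //; apply/subr0_eq/cnorm_eq0/eqP.
rewrite -[_ == _]negbK; apply/negP => nz.
have pos : 0 < cnorm (F l - l) by rewrite lt_def nz cnorm_ge0.
have [|n [un un1]] := lim0 (cnorm (F l - l) / 2); first by rewrite divr_gt0.
have := cnorm_dist_tri (F l) (u n.+1) l.
have := Fr _ _ lM (uM n); rewrite [cnorm (l - _)]cnorm_distC /=.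
by have := cnorm_ge0 (u n - l); nra.
Qed.

Lemma inverse_unique x y z : x * y = 1 -> z * x = 1 -> z = y.
Proof. by move=> xy zx; rewrite -[z]mulr1 -xy mulrA zx mul1r. Qed.

(** The right inverse is the fixed point of [y |-> 1 + x * y].  It commutes
    with [x], and so is a two-sided inverse, because [c = y * x - x * y]
    satisfies [c = x * c]. *)
Lemma neumann x r : cnorm x <= r < 1 ->
  exists y, [/\ (1 - x) * y = 1, y * (1 - x) = 1 & cnorm y <= (1 - r)^-1].
Proof.
move=> /andP[xr r1]; have r0 := le_trans (cnorm_ge0 x) xr.
have r1' : 0 < 1 - r by rewrite subr_gt0.
have [||y yM|y z yM zM|y yM yE] :=
    @fixed_point (fun y => 1 + x * y) (1 - r)^-1 r.
- by rewrite invr_ge0 ltW.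
- by rewrite r0.
- apply: le_trans (cnormD_le _ _) _; rewrite cnorm1.
  have := le_trans (cnormM_le x y) (ler_pM (cnorm_ge0 _) (cnorm_ge0 _) xr yM).
  have : (1 - r) * (1 - r)^-1 = 1 by rewrite mulfV ?gt_eqF.
  by nra.
- rewrite opprD addrACA subrr add0r -mulrBr.
  by apply: le_trans (cnormM_le _ _) _; rewrite ler_wpM2r ?cnorm_ge0.
have xy : y * x = x * y.
  apply/subr0_eq/(cnorm_le_eq0 r1).
  have {1}-> : y * x - x * y = x * (y * x - x * y).
    rewrite -{1 2}yE mulrDl mulrDr mul1r mulr1 opprD addrACA subrr add0r.
    by rewrite mulrBr !mulrA.
  apply: le_trans (cnormM_le _ _) _.
  by rewrite ler_wpM2r ?cnorm_ge0.
have yx : (1 - x) * y = 1 by rewrite mulrBl mul1r -{1}yE addrK.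
by exists y; split=> //; rewrite mulrBr mulr1 xy -{1}yE addrK.
Qed.

Lemma commute_inverse x y z : x * y = 1 -> y * x = 1 -> z * x = x * z ->
  z * y = y * z.
Proof.
move=> xy yx zx; rewrite -[LHS]mul1r -yx -!mulrA; congr (y * _).
by rewrite mulrA -zx -mulrA xy mulr1.
Qed.

(** The inverse is [c * (1 + r c)^-1], with a Neumann series for the second
    factor. *)
Lemma resolvent_shift x c r : x * c = 1 -> c * x = 1 -> 0 <= r ->
  r * cnorm c <= 2^-1 ->
  exists d, [/\ (x + r%:S) * d = 1, d * (x + r%:S) = 1 &
    cnorm d <= 2 * cnorm c].
Proof.
move=> xc cx r0 rc.
have [|v [v1 v2 vn]] := neumann (x := - (r *r c)) (r := 2^-1).
  rewrite cnormN cnorm_rscale ger0_norm// rc/=; lra.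
rewrite opprK in v1 v2.
have e1 : (x + r%:S) * c = 1 + r *r c by rewrite mulrDl xc rscalar_mull.
have e2 : c * (x + r%:S) = 1 + r *r c by rewrite mulrDr cx rscalar_mulr.
have d1 : (x + r%:S) * (c * v) = 1 by rewrite mulrA e1.
have d2 : (v * c) * (x + r%:S) = 1 by rewrite -mulrA e2.
exists (c * v); split=> //; first by rewrite -(inverse_unique d1 d2).
rewrite mulrC; apply: le_trans (cnormM_le _ _) _; apply: ler_wpM2l.
  exact: cnorm_ge0.
by have -> : 2 = (1 - 2^-1)^-1 :> R by field.
Qed.

Lemma invertibleZ (k : R[i]) x : k != 0 -> invertible x -> invertible (k *: x).
Proof.
move=> k0 [y [xy yx]]; exists (k^-1 *: y).
by rewrite -!scalerAl -!scalerAr xy yx !scalerA mulfV// mulVf// scale1r.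
Qed.

Lemma invertibleM x y : invertible x -> invertible y -> invertible (x * y).
Proof.
move=> [x' [xx' x'x]] [y' [yy' y'y]]; exists (y' * x'); split.
- by rewrite mulrA -[x * y * y']mulrA yy' mulr1.
- by rewrite mulrA -[y' * x' * x]mulrA x'x mulr1.
Qed.

Lemma invertibleN x : invertible x -> invertible (- x).
Proof.
by rewrite -scaleN1r; apply: invertibleZ; rewrite oppr_eq0 oner_eq0.
Qed.

Lemma spectrum_norm x (z : R[i]) : spectrum x z -> `|z| <= ((cnorm x)%:C)%C.
Proof.
move=> sz; rewrite real_leNgt ?normr_real//; last by rewrite complex_real.
apply/negP => zx; apply: sz.
have z0 : z != 0 by rewrite -normr_gt0 (le_lt_trans _ zx)// ler0c cnorm_ge0.
have -> : x - z%:A = (- z) *: (1 - z^-1 *: x).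
  by rewrite scalerBr scalerA mulNr mulfV// !scaleNr scale1r opprK addrC.
apply: invertibleZ; first by rewrite oppr_eq0.
have [|y [y1 y2 _]] := @neumann (z^-1 *: x) (cnorm (z^-1 *: x)); last first.
  by exists y.
rewrite lexx /= -ltcR cnormZ normfV mulrC ltr_pdivrMr ?normr_gt0//.
by rewrite mul1r.
Qed.

(** * Spectrum and norm of self-adjoint elements *)

Lemma selfadjointD x y : self_adjoint x -> self_adjoint y ->
  self_adjoint (x + y).
Proof. by rewrite /self_adjoint starD => -> ->. Qed.

Lemma selfadjointN x : self_adjoint x -> self_adjoint (- x).
Proof. by rewrite /self_adjoint starN => ->. Qed.

Lemma selfadjointB x y : self_adjoint x -> self_adjoint y ->
  self_adjoint (x - y).
Proof. by move=> xs ys; apply: selfadjointD => //; exact: selfadjointN. Qed.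

Lemma selfadjointZ r x : self_adjoint x -> self_adjoint (r *r x).
Proof. by rewrite /self_adjoint star_rscale => ->. Qed.

Lemma selfadjoint_rscalar r : self_adjoint (r%:S).
Proof. exact: star_rscalar. Qed.

Lemma selfadjointM x y : self_adjoint x -> self_adjoint y -> x * y = y * x ->
  self_adjoint (x * y).
Proof. by rewrite /self_adjoint starM => -> ->. Qed.

Lemma selfadjoint_inverse x y : self_adjoint x -> x * y = 1 -> y * x = 1 ->
  self_adjoint y.
Proof.
move=> xs xy yx; apply: (inverse_unique xy).
by rewrite -{1}xs -starM xy star1.
Qed.

(** The C*-identity for the normal element [x + i y], whose adjoint is
    [x - i y]. *)
Lemma cnorm_cartesian x y : self_adjoint x -> self_adjoint y -> x * y = y * x ->
  cnorm (x + 'i%C *: y) ^+ 2 = cnorm (x * x + y * y).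
Proof.
move=> xs ys xy; rewrite -cnorm_starM starD starZ xs ys; congr cnorm.
have -> : conjc 'i%C = - 'i%C :> R[i].
  by apply/eqP; rewrite eq_complex /= oppr0 !eqxx.
rewrite mulrDl !mulrDr -!scalerAl -!scalerAr scalerA.
have -> : - 'i%C * 'i%C = 1 :> R[i] by rewrite mulNr -expr2 sqr_i opprK.
by rewrite scale1r addrA -[_ + _ *: (y * x)]addrA xy scaleNr subrr addr0.
Qed.

Lemma cnorm_re_le x y : self_adjoint x -> self_adjoint y ->
  cnorm x <= cnorm (x + 'i%C *: y).
Proof.
move=> xs ys; set w := x + _.
have sw : star w = x - 'i%C *: y.
  rewrite starD starZ xs ys -scaleNr; congr (_ + _ *: _).
  by apply/eqP; rewrite eq_complex /= oppr0 !eqxx.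
have := cnormD_le w (star w); rewrite cnorm_star sw /w addrACA subrr addr0.
have -> : x + x = 2 *r x by rewrite rmorph_nat scaler_nat.
by rewrite cnorm_rscale ger0_norm//; lra.
Qed.

Lemma spectrum_shift x (z w : R[i]) : spectrum x z ->
  spectrum (x + w%:A) (z + w).
Proof.
by rewrite /spectrum /= scalerDl opprD addrACA subrr addr0.
Qed.

Lemma spectrumN x (z : R[i]) : spectrum x z -> spectrum (- x) (- z).
Proof.
rewrite /spectrum /= scaleNr opprK => nz inv; apply: nz.
rewrite -[x - _]opprK opprB -scaleN1r; apply: invertibleZ.
  by rewrite oppr_eq0 oner_eq0.
by rewrite addrC.
Qed.

Lemma spectrum_subr t x (z : R[i]) :
  spectrum (t%:S - x) z -> spectrum x ((t%:C)%C - z).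
Proof.
move=> /spectrumN /(spectrum_shift (w := (t%:C)%C)).
by rewrite opprB subrK addrC.
Qed.

(** Translating [x] by [i t] moves [a + i b] to [a + i (b + t)], whose squared
    modulus is at most [cnorm (x + i t)^2 <= cnorm x^2 + t^2]; the [t^2]
    cancel, and the remaining term [2 b t] is unbounded unless [b = 0]. *)
Lemma spectrum_selfadjoint x (z : R[i]) : self_adjoint x -> spectrum x z ->
  z = ((complex.Re z)%:C)%C.
Proof.
move=> xs; case: z => a b sz; suff -> : b = 0 by [].
have le t : a ^+ 2 + b ^+ 2 + 2 * b * t <= cnorm x ^+ 2.
  have := spectrum_norm (spectrum_shift (w := 'i%C * (t%:C)%C) sz).
  rewrite -scalerA.
  have := cnorm_cartesian xs (selfadjoint_rscalar t).
  rewrite rscalar_mulr rscalar_mull => /(_ erefl) e.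
  have le : cnorm (x + 'i%C *: t%:S) ^+ 2 <= cnorm x ^+ 2 + t ^+ 2.
    rewrite e; apply: le_trans (cnormD_le _ _) _.
    by rewrite cnorm_sqr// -rscalarM cnorm_rscalar -expr2 ger0_norm ?sqr_ge0.
  rewrite normc_def lecR /= => le2.
  have : (a + (0 * t - 1 * 0)) ^+ 2 + (b + (0 * 0 + 1 * t)) ^+ 2 <=
      cnorm (x + 'i%C *: t%:S) ^+ 2.
    rewrite -ler_sqrt ?sqr_ge0// sqrtr_sqr ger0_norm ?cnorm_ge0//.
  nra.
apply/eqP; rewrite -[_ == _]negbK; apply/negP => b0.
(* The value of [t] for which [2 * b * t] exceeds [cnorm x ^+ 2] by [1]. *)
have := le ((cnorm x ^+ 2 + 1) / (2 * b)).
rewrite mulrCA mulfV ?mulf_neq0// mulr1.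
by nra.
Qed.

(** With [b = 1 - x], the root is [1 - g] where [g = (b + g^2) / 2], a fixed
    point of a contraction of the ball of radius [cnorm b].  That [g] is
    self-adjoint and commutes with the commutant of [x] follows from the
    contraction estimate: the difference [star g - g], or the commutator
    [z * g - g * z], is bounded in norm by [cnorm b < 1] times itself. *)
Lemma sqrt_near_1 x : self_adjoint x -> cnorm (1 - x) < 1 ->
  exists k, [/\ self_adjoint k, k * k = x &
    forall z, z * x = x * z -> z * k = k * z].
Proof.
move=> xs x1; set b : A := 1 - x in x1; pose r := cnorm b.
have bs : self_adjoint b by apply: selfadjointB => //; exact: star1.
have r0 : 0 <= r by exact: cnorm_ge0.
pose F (g : A) : A := 2^-1 *r (b + g * g).
have half (y : A) : cnorm (2^-1 *r y) = 2^-1 * cnorm y.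
  by rewrite cnorm_rscale ger0_norm.
have sqrB (g h : A) : g * g - h * h = (g - h) * g + h * (g - h).
  by rewrite mulrBl mulrBr addrA subrK.
have FE g h : F g - F h = 2^-1 *r ((g - h) * g + h * (g - h)).
  by rewrite /F -scalerBr opprD addrACA subrr add0r sqrB.
have nsum g h y : cnorm g <= r -> cnorm h <= r ->
    cnorm (2^-1 *r (y * g + h * y)) <= r * cnorm y.
  move=> gr hr; rewrite half.
  have := le_trans (cnormM_le y g) (ler_wpM2l (cnorm_ge0 y) gr).
  have := le_trans (cnormM_le h y) (ler_wpM2r (cnorm_ge0 y) hr).
  by have := cnormD_le (y * g) (h * y); lra.
have FC g h : cnorm g <= r -> cnorm h <= r ->
    cnorm (F g - F h) <= r * cnorm (g - h).
  by move=> gr hr; rewrite FE; exact: nsum.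
have [|g gr|g h gr hr|g gr gF] := fixed_point (F := F) (M := r) (r := r) r0.
- by rewrite r0.
- rewrite /F half.
  have := le_trans (cnormM_le g g) (ler_pM (cnorm_ge0 g) (cnorm_ge0 g) gr gr).
  by have := cnormD_le b (g * g); rewrite -/r; have : r < 1 := x1; nra.
- exact: FC.
have gg : g * g = g + g - b.
  apply/esym; rewrite -[g + g]mulr2n -scaler_nat -{1}gF /F scalerA.
  by rewrite fmorphV rmorph_nat mulfV ?pnatr_eq0// scale1r addrC addKr.
have gs : star g = g.
  apply/subr0_eq/(cnorm_le_eq0 x1).
  have {1}-> : star g - g = F (star g) - F g.
    by rewrite gF -{1}gF star_rscale starD starM bs.
  by apply: FC => //; rewrite cnorm_star.
exists (1 - g); split.
- by apply: selfadjointB => //; exact: star1.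
- rewrite mulrBl mul1r mulrBr mulr1 gg -[x](subKr 1) -/b.
  have -> : g - (g + g - b) = b - g by rewrite opprB addrCA opprD addNKr.
  by rewrite opprB addrA subrK.
- move=> z zx; suff zg : z * g = g * z by rewrite mulrBr mulrBl mulr1 mul1r zg.
  have zb : z * b = b * z by rewrite mulrBr mulrBl mulr1 mul1r zx.
  apply/subr0_eq/(cnorm_le_eq0 x1).
  have {1}-> : z * g - g * z =
      2^-1 *r ((z * g - g * z) * g + g * (z * g - g * z)).
    rewrite -{1 2}gF -scalerAr -scalerAl -scalerBr; congr (_ *: _).
    rewrite mulrDr mulrDl zb opprD addrACA subrr add0r.
    by rewrite mulrBl mulrBr !mulrA addrA subrK.
  exact: nsum.
Qed.

Lemma sqrt_near_scalar t x : self_adjoint x -> cnorm (t%:S - x) < t ->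
  exists k, [/\ self_adjoint k, k * k = x &
    forall z, z * x = x * z -> z * k = k * z].
Proof.
move=> xs xt; have t0 : 0 < t := le_lt_trans (cnorm_ge0 _) xt.
have tV : (t%:C)%C * (t^-1%:C)%C = 1 :> R[i].
  by rewrite -rmorphM mulfV ?gt_eqF.
have [||k [ks kk kc]] := sqrt_near_1 (x := t^-1 *r x).
- exact: selfadjointZ.
- rewrite -(ltr_pM2l t0) mulr1 -{1}[t]ger0_norm ?(ltW t0)// -cnorm_rscale.
  by rewrite scalerBr scalerA tV scale1r.
exists (Num.sqrt t *r k); split; first exact: selfadjointZ.
- rewrite -scalerAl -scalerAr scalerA -rmorphM -expr2 sqr_sqrtr ?(ltW t0)//.
  by rewrite kk scalerA tV scale1r.
- move=> z zx; rewrite -scalerAl -scalerAr kc//.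
  by rewrite -scalerAl -scalerAr zx.
Qed.

(** The substitute for the spectral radius formula.  Since [m^2 - d - y^2] is
    not known to be close to a scalar, its square root is built as a product
    [h * w]: with [H = m^2 + d - y^2], which is within [m^2] of the scalar
    [m^2 + d], take [h] a root of [H] and [w] a root of [1 - 2 d H^-1], so that
    [(h * w)^2 = H - 2 d]. *)
Lemma norm_in_spectrum y : self_adjoint y ->
  spectrum y ((cnorm y)%:C)%C \/ spectrum y ((- cnorm y)%:C)%C.
Proof.
move=> ys; apply: contrapT => /not_orP[/contrapT inv1 /contrapT inv2].
set m := cnorm y in inv1 inv2.
have m0 : 0 < m.
  rewrite lt_def cnorm_ge0 andbT; apply/eqP => me; move: inv1.
  rewrite me scale0r subr0 (cnorm_eq0 y me) => -[z [/eqP]].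
  by rewrite mul0r eq_sym oner_eq0.
have yr r : y * r%:S = r%:S * y by rewrite rscalar_mull rscalar_mulr.
have [c [xc cx]] : invertible ((m ^+ 2)%:S - y * y).
  rewrite -opprB; apply: invertibleN.
  suff <- : (y - m%:S) * (y - (- m)%:S) = y * y - (m ^+ 2)%:S.
    exact: invertibleM.
  rewrite rmorphN scaleNr opprK mulrDr !mulrBl -rscalarM -expr2 yr.
  by rewrite addrA subrK.
set x := _ - y * y in xc cx; set C := cnorm c.
have ys2 : self_adjoint (y * y) by exact: selfadjointM.
have C0 : 1 <= 2 * m ^+ 2 * C.
  rewrite -{1}cnorm1 -xc; apply: le_trans (cnormM_le _ _) _.
  apply: ler_wpM2r; first exact: cnorm_ge0.
  apply: le_trans (cnormD_le _ _) _; rewrite cnormN cnorm_sqr// cnorm_rscalar.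
  by rewrite ger0_norm ?sqr_ge0// -/m; lra.
have Cpos : 0 < C.
  by rewrite lt_def cnorm_ge0 andbT; apply/eqP => C_0; rewrite C_0 in C0; lra.
(* This [d] makes [H] invertible with an inverse of norm at most [2 * C], so
   that [2 * d * H^-1] has norm at most [1/2]; by [C0] it is below [m ^+ 2]. *)
pose d := (8 * C)^-1.
have d0 : 0 < d by rewrite invr_gt0; lra.
have dC : d * C = 8^-1 by rewrite /d; field; rewrite gt_eqF.
have dm : d < m ^+ 2.
  by have m2 : 0 < m ^+ 2 := exprn_gt0 2 m0; nra.
have [||c' [Hc c'H nc']] := resolvent_shift xc cx (r := d).
- exact: ltW.
- by rewrite -/C dC; lra.
set H := x + d%:S in Hc c'H.
have HE : H = (m ^+ 2 + d)%:S - y * y by rewrite rscalarD /H /x addrAC.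
have Hs : self_adjoint H.
  by rewrite HE; apply: selfadjointB => //; exact: selfadjoint_rscalar.
have c's : self_adjoint c' := selfadjoint_inverse Hs Hc c'H.
have yH : y * H = H * y by rewrite HE mulrBr mulrBl yr mulrA.
have [|h [hs hh hc]] := sqrt_near_scalar (t := m ^+ 2 + d) Hs.
  by rewrite HE subKr cnorm_sqr// -/m; lra.
pose W := 1 - (2 * d) *r c'.
have Wcomm z : z * H = H * z -> z * W = W * z.
  move=> zH; rewrite /W mulrBr mulrBl mulr1 mul1r -scalerAl -scalerAr.
  by rewrite (commute_inverse Hc c'H zH).
have [||w [ws ww wc]] := sqrt_near_1 (x := W).
- by apply: selfadjointB; [exact: star1|exact: selfadjointZ].
- rewrite subKr cnorm_rscale ger0_norm; last lra.
  by rewrite -/C in nc'; nra.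
have hw : h * w = w * h by apply: wc; apply: Wcomm; rewrite -hh mulrA.
have yk : y * (h * w) = (h * w) * y.
  by rewrite mulrA (hc _ yH) -!mulrA (wc _ (Wcomm _ yH)).
have ks : self_adjoint (h * w) by exact: selfadjointM.
have kk : y * y + (h * w) * (h * w) = (m ^+ 2 - d)%:S.
  have -> : (h * w) * (h * w) = H * W.
    by rewrite -mulrA [w * (h * w)]mulrA -hw -mulrA ww mulrA hh.
  rewrite /W mulrBr mulr1 -scalerAr Hc HE addrCA addrA subrK -rscalarB.
  by congr _%:S; lra.
have := cnorm_cartesian ys ks yk; rewrite kk cnorm_rscalar ger0_norm; last lra.
have := cnorm_re_le ys ks; rewrite -/m.
by nra.
Qed.

(** * Positive elements *)

(** With [cnorm_subr_positive], this trades the spectral definition of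
    positivity for a norm inequality, which is stable under sums.  If [n], the
    norm of [t - x], exceeded [t], then one of [t - n] and [t + n] would lie in
    the spectrum of [x]; the first is negative, the second exceeds
    [cnorm x]. *)
Lemma positive_cnorm_subr t x : positive x -> cnorm x <= t ->
  cnorm (t%:S - x) <= t.
Proof.
move=> xp xt; rewrite leNgt; apply/negP; set n := cnorm _ => tn.
have t0 : 0 <= t := le_trans (cnorm_ge0 _) xt.
have xs : self_adjoint (t%:S - x).
  by apply: selfadjointB xp.1; exact: selfadjoint_rscalar.
have [|] := norm_in_spectrum xs; rewrite -/n => /spectrum_subr.
- by move=> /xp.2; rewrite /= -rmorphB ler0c; lra.
- move=> /spectrum_norm; rewrite -rmorphB normc_real lecR opprK ger0_norm; lra.
Qed.

Lemma cnorm_subr_positive t x : self_adjoint x -> cnorm (t%:S - x) <= t ->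
  positive x.
Proof.
move=> xs xt; split=> // z sz.
have := spectrum_norm (spectrum_shift (w := (t%:C)%C) (spectrumN sz)).
rewrite (spectrum_selfadjoint xs sz) -rmorphN -rmorphD [- x + _]addrC.
rewrite normc_real lecR /= ler0c => le.
by have := ler_norm (- complex.Re z + t); lra.
Qed.

Lemma positive_norm_subr x : self_adjoint x -> positive ((cnorm x)%:S - x).
Proof.
move=> xs; apply: (@cnorm_subr_positive (cnorm x)).
  by apply: selfadjointB => //; exact: selfadjoint_rscalar.
by rewrite subKr.
Qed.

Lemma positiveD x y : positive x -> positive y -> positive (x + y).
Proof.
move=> xp yp; apply: (@cnorm_subr_positive (cnorm x + cnorm y)).
  exact: selfadjointD xp.1 yp.1.
rewrite rscalarD opprD addrACA; apply: le_trans (cnormD_le _ _) _.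
by apply: lerD; exact: positive_cnorm_subr.
Qed.

Lemma positive0 : positive (0 : A).
Proof.
apply: (@cnorm_subr_positive 0); first by rewrite /self_adjoint star0.
by rewrite subr0 cnorm_rscalar normr0.
Qed.

Lemma positive_spectrum_norm y : positive y -> spectrum y ((cnorm y)%:C)%C.
Proof.
move=> yp; have [//|sn] := norm_in_spectrum yp.1.
have := yp.2 _ sn; rewrite /= ler0c oppr_ge0 => n0.
have e : cnorm y = 0 by apply/le_anti; rewrite n0 cnorm_ge0.
by move: sn; rewrite e oppr0.
Qed.

(** Equality holds in the triangle inequality because [cnorm y] is itself in
    the spectrum of [y]. *)
Lemma cnorm_positiveD t y : positive y -> 0 <= t ->
  cnorm (t%:S + y) = t + cnorm y.
Proof.
move=> yp t0; apply/le_anti/andP; split.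
  by apply: le_trans (cnormD_le _ _) _; rewrite cnorm_rscalar ger0_norm.
have := positive_spectrum_norm yp.
move=> /(spectrum_shift (w := (t%:C)%C)) /spectrum_norm.
rewrite -rmorphD normc_real lecR ger0_norm ?addr_ge0 ?cnorm_ge0//.
by rewrite [y + _]addrC [cnorm y + t]addrC.
Qed.

End CStarAlgebra.

(** * Morphisms preserving the involution *)

Section StarMorphisms.
Local Open Scope ring_scope.
Context (R : realType) (A B : cstarAlgType R).
Implicit Types x y : A.

Lemma spectrum_morph_sub (f : {lrmorphism A -> B}) x (z : R[i]) :
  spectrum (f x) z -> spectrum x z.
Proof.
move=> nz [y [xy yx]]; apply: nz; exists (f y).
have -> : f x - z%:A = f (x - z%:A).
  by rewrite raddfB; congr (_ - _); exact: esym (rmorph_alg f z).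
by rewrite -!rmorphM xy yx rmorph1.
Qed.

Lemma positive_morph (f : {lrmorphism A -> B}) x :
  (forall y, f (star y) = star (f y)) -> positive x -> positive (f x).
Proof.
move=> fs [xs xp]; split; first by rewrite /self_adjoint -fs xs.
by move=> z /spectrum_morph_sub; exact: xp.
Qed.

(** By the C*-identity it suffices to treat [y = star x * x].  The norm of
    [f y], up to sign, is in the spectrum of [f y], hence in that of [y]. *)
Lemma cnorm_morph_le (f : {lrmorphism A -> B}) x :
  (forall y, f (star y) = star (f y)) -> cnorm (f x) <= cnorm x.
Proof.
move=> fs; rewrite -ler_sqr ?nnegrE ?cnorm_ge0//.
rewrite -(cnorm_starM x) -(cnorm_starM (f x)) -fs -rmorphM.
set y := star x * x.
have ys : self_adjoint y by rewrite /self_adjoint starM starK.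
have fys : self_adjoint (f y) by rewrite /self_adjoint -fs ys.
have le (r : R) : spectrum (f y) (r%:C)%C -> `|r| <= cnorm y.
  by move=> /spectrum_morph_sub /spectrum_norm; rewrite normc_real lecR.
by have [/le|/le] := norm_in_spectrum fys; rewrite ?normrN ger0_norm ?cnorm_ge0.
Qed.

End StarMorphisms.

Section OrbitSums.
Local Open Scope classical_set_scope.
Local Open Scope ring_scope.
Context (R : realType) (A : cstarAlgType R) (Theta : z_action A).
Implicit Types (r s t : R) (x y z : A).

Local Notation "r *r x" := ((r%:C)%C *: x) (at level 40).
Local Notation "r %:S" := ((r%:C)%C *: (1 : A))
  (at level 2, format "r %:S").

(** * Orbit sums and the gauge *)

Definition orbit_sum k x : A := \sum_(0 <= j < k) Theta j%:Z x.

Lemma orbit_sumD k x y : orbit_sum k (x + y) = orbit_sum k x + orbit_sum k y.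
Proof.
by rewrite /orbit_sum -big_split; apply: eq_bigr => j _; rewrite raddfD.
Qed.

Lemma orbit_sumZ k (z : R[i]) x : orbit_sum k (z *: x) = z *: orbit_sum k x.
Proof.
by rewrite /orbit_sum scaler_sumr; apply: eq_bigr => j _; rewrite linearZ.
Qed.

Lemma orbit_sum1 x : orbit_sum 1 x = x.
Proof. by rewrite /orbit_sum big_nat1 theta0. Qed.

Lemma orbit_sum_add k l x :
  orbit_sum (k + l) x = orbit_sum k x + Theta k%:Z (orbit_sum l x).
Proof.
rewrite /orbit_sum (big_cat_nat (n := k)) ?leq_addr//=; congr (_ + _).
rewrite -{1}[k]add0n big_addn addKn raddf_sum.
by apply: eq_bigr => j _; rewrite addnC PoszD thetaD.
Qed.

Lemma orbit_sum_coboundary n x : orbit_sum n (Theta 1 x - x) = Theta n x - x.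
Proof.
have := telescope_sumr (fun j : nat => Theta j%:Z x) (leq0n n).
rewrite theta0 => <-; rewrite /orbit_sum.
by apply: eq_bigr => j _; rewrite raddfB -addn1 PoszD thetaD.
Qed.

Lemma cnorm_theta_le j x : cnorm (Theta j x) <= cnorm x.
Proof. by apply: cnorm_morph_le => y; exact: theta_star. Qed.

(** Cutting an orbit sum of length [l * k] into [l] blocks, each a translate of
    the first.  The scalar [t] rides along, being fixed by the action; [t = 0]
    gives the subadditivity behind the gauge. *)
Lemma cnorm_orbit_sum_mul l k t x :
  cnorm ((l%:R * t)%:S + orbit_sum (l * k) x) <=
  l%:R * cnorm (t%:S + orbit_sum k x).
Proof.
elim: l => [|l IHl].
  by rewrite !mul0r mul0n /orbit_sum big_nil addr0 rmorph0 scale0r cnorm0.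
have -> : (l.+1%:R * t)%:S + orbit_sum (l.+1 * k) x =
    (t%:S + orbit_sum k x) + Theta k%:Z ((l%:R * t)%:S + orbit_sum (l * k) x).
  have -> y : Theta k%:Z ((l%:R * t)%:S + y) = (l%:R * t)%:S + Theta k%:Z y.
    by rewrite raddfD; congr (_ + _); exact: rmorph_alg.
  rewrite mulSn orbit_sum_add addrACA; congr (_ + _).
  by rewrite -rscalarD mulrSr mulrDl mul1r addrC.
apply: le_trans (cnormD_le _ _) _; rewrite mulrSr mulrDl mul1r addrC lerD2r.
exact: le_trans (cnorm_theta_le _ _) IHl.
Qed.

Lemma cnorm_orbit_sum k x : cnorm (orbit_sum k x) <= k%:R * cnorm x.
Proof.
have := cnorm_orbit_sum_mul k 1 0 x.
by rewrite mulr0 rmorph0 scale0r !add0r muln1 orbit_sum1.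
Qed.

Lemma orbit_sum_positive k x : positive x -> positive (orbit_sum k x).
Proof.
move=> xp; apply: big_ind => [|y z|j _]; first exact: positive0.
- exact: positiveD.
- by apply: positive_morph => // y; exact: theta_star.
Qed.

Lemma gauge_seqE x k : gauge_seq Theta x k = k%:R^-1 * cnorm (orbit_sum k x).
Proof. by []. Qed.

Lemma gauge_seq_ge0 x k : 0 <= gauge_seq Theta x k.
Proof. by rewrite mulr_ge0 ?invr_ge0 ?cnorm_ge0. Qed.

(** Divide [n] by [k]: the quotient counts full blocks, and the remainder adds
    at most [k] terms. *)
Lemma gauge_seq_le x k n : (0 < k)%N -> (0 < n)%N ->
  gauge_seq Theta x n <= gauge_seq Theta x k + k%:R * cnorm x / n%:R.
Proof.
move=> k0 n0.
have n0' : 0 < n%:R :> R by rewrite ltr0n.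
have k0' : 0 < k%:R :> R by rewrite ltr0n.
rewrite !gauge_seqE ler_pdivrMl// mulrDr [n%:R * (_ / _)]mulrC divfK ?gt_eqF//.
rewrite {1}(divn_eq n k) orbit_sum_add; apply: le_trans (cnormD_le _ _) _.
apply: lerD.
- have := cnorm_orbit_sum_mul (n %/ k) k 0 x.
  rewrite mulr0 rmorph0 scale0r !add0r => /le_trans; apply.
  rewrite mulrA ler_wpM2r ?cnorm_ge0// ler_pdivlMr//.
  by rewrite -natrM ler_nat leq_trunc_div.
- apply: le_trans (cnorm_theta_le _ _) _.
  apply: le_trans (cnorm_orbit_sum _ _) _.
  by rewrite ler_wpM2r ?cnorm_ge0// ler_nat ltnW// ltn_pmod.
Qed.

(** Fekete's lemma.  The index [0] is left out because the sequence takes the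
    conventional value [0] there. *)
Lemma gauge_cvg x : gauge_seq Theta x @ \oo -->
  inf [set gauge_seq Theta x k | k in [set k | (0 < k)%N]].
Proof.
set G := [set _ | _ in _].
have lbG : has_lbound G by exists 0 => _ [k _ <-]; exact: gauge_seq_ge0.
have G0 : G !=set0 by exists (gauge_seq Theta x 1), 1%N.
apply/cvgrPdist_le => e e0.
have e20 : 0 < e / 2 by rewrite divr_gt0.
have [_ [k /= k0 <-] gk] := inf_adherent e20 (conj G0 lbG).
pose c := k%:R * cnorm x / (e / 2).
have c0 : 0 <= c by rewrite divr_ge0 ?mulr_ge0 ?cnorm_ge0// ltW.
have cN := archi_boundP c0; exists (Num.bound c) => // n /= Nn.
have cn : c < n%:R by apply: lt_le_trans cN _; rewrite ler_nat.
have n0 : (0 < n)%N by rewrite -(ltr_nat R); exact: le_lt_trans c0 cn.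
have infn : inf G <= gauge_seq Theta x n by apply: ge_inf => //; exists n.
rewrite ler0_norm ?subr_le0// opprB.
have := gauge_seq_le x k0 n0.
have : k%:R * cnorm x / n%:R < e / 2.
  by rewrite ltr_pdivrMr ?ltr0n// [e / 2 * _]mulrC -ltr_pdivrMr.
lra.
Qed.

Lemma gaugeE x : gauge Theta x =
  inf [set gauge_seq Theta x k | k in [set k | (0 < k)%N]].
Proof. exact/cvg_lim/gauge_cvg. Qed.

(** [phi] sees every orbit sum as [k * phi x] and is bounded by the norm on
    self-adjoint elements. *)
Lemma invariant_state_le_gauge (phi : {scalar A}) x : self_adjoint x ->
  invariant_states Theta phi -> complex.Re (phi x) <= gauge Theta x.
Proof.
move=> xs [[phi_ge0 phi1] phi_inv]; rewrite gaugeE; apply: lb_le_inf.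
  by exists (gauge_seq Theta x 1), 1%N.
move=> _ [k /= k0 <-]; rewrite gauge_seqE ler_pdivlMl ?ltr0n//.
set S := orbit_sum k x.
have Ss : self_adjoint S.
  rewrite /S /orbit_sum; apply: (big_ind (@self_adjoint R A)) => [|y z|j _].
  - exact: star0.
  - exact: selfadjointD.
  - by rewrite /self_adjoint -theta_star xs.
have phiS : phi S = k%:R * phi x.
  rewrite raddf_sum (eq_bigr (fun=> phi x)) => [|j _]; last exact: phi_inv.
  by rewrite big_const_nat subn0 iter_addr_0 mulr_natl.
have := phi_ge0 _ (positive_norm_subr Ss).
rewrite linearB linearZ /= phi1 phiS mulr1 lecE /= => /andP[_].
rewrite -(rmorph_nat (real_complex R)); case: (phi x) => u v /=.
by rewrite mul0r subr0 subr_ge0.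
Qed.

(** * The upper mean and its invariant states *)

(** Up to the scaling of [t] by [k], the amount by which the mean of the first
    [k] translates of [x] increases the norm of a scalar.  For self-adjoint [x]
    and large [t] this is the maximum of the spectrum of the mean. *)
Definition mean_excess k t x : R :=
  k%:R^-1 * (cnorm (t%:S + orbit_sum k x) - t).

Definition mean_excesses x : set R :=
  [set e | exists k t, [/\ (0 < k)%N, 0 <= t & e = mean_excess k t x]].

Definition upper_mean (x : restrict_scalars A) : R := inf (mean_excesses x).

Lemma mean_excesses_lb x : has_lbound (mean_excesses x).
Proof.
exists (- cnorm x) => _ [k [t [k0 t0 ->]]].
rewrite /mean_excess ler_pdivlMl ?ltr0n// mulrN.
have := cnormD_le (t%:S + orbit_sum k x) (- orbit_sum k x).
rewrite addrK cnormN cnorm_rscalar ger0_norm//.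
by have := cnorm_orbit_sum k x; lra.
Qed.

Lemma mean_excess_ge k t x : (0 < k)%N -> 0 <= t ->
  upper_mean x <= mean_excess k t x.
Proof.
by move=> k0 t0; apply: ge_inf; [exact: mean_excesses_lb|exists k, t].
Qed.

(** For the triangle inequality, two lengths [k] and [l] are compared at their
    common multiple [l * k], where block cutting bounds each excess. *)
Lemma upper_mean_sublinear : sublinear upper_mean.
Proof.
apply: (sublinear_inf (V := restrict_scalars A) (E := mean_excesses)).
- by move=> x; exists (mean_excess 1 0 x), 1%N, 0.
- exact: mean_excesses_lb.
- move=> x y _ _ [k [t [k0 t0 ->]]] [l [s [l0 s0 ->]]].
  exists (mean_excess (l * k) (l%:R * t + k%:R * s) (x + y)).
    exists (l * k)%N, (l%:R * t + k%:R * s).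
    by rewrite muln_gt0 l0 k0 addr_ge0 ?mulr_ge0.
  have k0' : 0 < k%:R :> R by rewrite ltr0n.
  have l0' : 0 < l%:R :> R by rewrite ltr0n.
  rewrite /mean_excess orbit_sumD rscalarD addrACA natrM.
  have := cnorm_orbit_sum_mul l k t x.
  have := cnorm_orbit_sum_mul k l s y; rewrite [(k * l)%N]mulnC.
  move=> vle ule; have := cnormD_le ((l%:R * t)%:S + orbit_sum (l * k) x)
    ((k%:R * s)%:S + orbit_sum (l * k) y).
  rewrite ler_pdivrMl ?mulr_gt0// mulrDr.
  have -> : l%:R * k%:R * (k%:R^-1 * (cnorm (t%:S + orbit_sum k x) - t)) =
    l%:R * (cnorm (t%:S + orbit_sum k x) - t).
    by rewrite -mulrA mulVKf ?gt_eqF.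
  have -> : l%:R * k%:R * (l%:R^-1 * (cnorm (s%:S + orbit_sum l y) - s)) =
    k%:R * (cnorm (s%:S + orbit_sum l y) - s).
    by rewrite [l%:R * _]mulrC -mulrA mulVKf ?gt_eqF.
  by lra.
- move=> r x _ r0 [k [t [k0 t0 ->]]]; exists (mean_excess k (r * t) (r *r x)).
    by exists k, (r * t); rewrite mulr_ge0// ltW.
  rewrite /mean_excess orbit_sumZ rmorphM -scalerA -scalerDr cnorm_rscale.
  by rewrite ger0_norm ?(ltW r0)// -mulrBr mulrCA.
Qed.

Lemma mean_excess1 t x : mean_excess 1 t x = cnorm (t%:S + x) - t.
Proof. by rewrite /mean_excess orbit_sum1 invr1 mul1r. Qed.

Lemma upper_meanN_positive x : positive x -> upper_mean (- x) <= 0.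
Proof.
move=> xp; apply: le_trans (mean_excess_ge _ (ltn0Sn 0) (cnorm_ge0 x)) _.
by rewrite mean_excess1 subr_le0 positive_cnorm_subr.
Qed.

Lemma upper_mean1 : upper_mean (1 : A) <= 1.
Proof.
apply: le_trans (mean_excess_ge (t := 0) _ (ltn0Sn 0) (lexx _)) _.
by rewrite mean_excess1 rmorph0 scale0r add0r cnorm1 subr0.
Qed.

Lemma upper_meanN1 : upper_mean (- 1 : A) <= -1.
Proof.
apply: le_trans (mean_excess_ge (t := 1) _ (ltn0Sn 0) ler01) _.
by rewrite mean_excess1 rmorph1 scale1r subrr cnorm0 sub0r.
Qed.

(** [cnorm (t + i x)] is at most the square root of [t^2 + cnorm x^2], which
    exceeds [t] by an amount tending to [0] as [t] grows. *)
Lemma upper_mean_imaginary x : self_adjoint x -> upper_mean ('i%C *: x) <= 0.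
Proof.
move=> xs; rewrite leNgt; apply/negP => e0; set e := upper_mean _ in e0.
pose t := cnorm x ^+ 2 / (2 * e).
have t0 : 0 <= t by rewrite divr_ge0 ?sqr_ge0// mulr_ge0// ltW.
have := mean_excess_ge ('i%C *: x) (ltn0Sn 0) t0; rewrite -/e mean_excess1.
have := cnorm_cartesian (selfadjoint_rscalar A t) xs.
rewrite rscalar_mull rscalar_mulr => /(_ erefl).
set n := cnorm _ => nE.
have : n ^+ 2 <= t ^+ 2 + cnorm x ^+ 2.
  rewrite nE; apply: le_trans (cnormD_le _ _) _.
  by rewrite -rscalarM cnorm_rscalar cnorm_sqr// -expr2 ger0_norm ?sqr_ge0.
have : 2 * e * t = cnorm x ^+ 2 by rewrite mulrC divfK// gt_eqF// mulr_gt0.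
by nra.
Qed.

Lemma upper_mean_coboundary x : upper_mean (Theta 1 x - x) <= 0.
Proof.
rewrite leNgt; apply/negP => e0; set e := upper_mean _ in e0.
pose c := 2 * cnorm x / e.
have c0 : 0 <= c by rewrite divr_ge0 ?mulr_ge0 ?cnorm_ge0// ltW.
have cN := archi_boundP c0; set n := Num.bound c in cN.
have n0 : 0 < n%:R :> R := le_lt_trans c0 cN.
have := mean_excess_ge (Theta 1 x - x) (_ : (0 < n)%N) (lexx 0).
rewrite -(ltr_nat R) => /(_ n0); rewrite -/e /mean_excess orbit_sum_coboundary.
rewrite ler_pdivlMl// rmorph0 scale0r add0r subr0.
have := cnormD_le (Theta n x) (- x); rewrite cnormN.
have := cnorm_theta_le n x.
by move: cN; rewrite /c ltr_pdivrMr//; lra.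
Qed.

Lemma invariant_of_generator (T : Type) (f : A -> T) :
  (forall x, f (Theta 1 x) = f x) -> forall j x, f (Theta j x) = f x.
Proof.
move=> f1.
have fn (n : nat) x : f (Theta n x) = f x.
  elim: n x => [|n IHn] x; first by rewrite theta0.
  by rewrite -addn1 PoszD thetaD IHn f1.
move=> [n|n] x; first exact: fn.
by rewrite -(fn n.+1) -thetaD NegzE subrr theta0.
Qed.

Lemma gauge_le_upper_mean x : positive x -> gauge Theta x <= upper_mean x.
Proof.
move=> xp; apply: lb_le_inf; first by exists (mean_excess 1 0 x), 1%N, 0.
move=> _ [k [t [k0 t0 ->]]].
rewrite /mean_excess cnorm_positiveD//; last exact: orbit_sum_positive.
rewrite addrAC subrr add0r -gauge_seqE gaugeE; apply: ge_inf; last by exists k.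
by exists 0 => _ [n _ <-]; exact: gauge_seq_ge0.
Qed.

(** Each property of the state is read off from [f <= upper_mean] at a vector
    and, for equalities, at its opposite. *)
Lemma exists_invariant_state x : positive x -> exists2 phi : {scalar A},
  invariant_states Theta phi & gauge Theta x <= complex.Re (phi x).
Proof.
move=> xp.
have [f fle fx] :=
  hahn_banach (x : restrict_scalars A) upper_mean_sublinear.
have [phi phiE] := complexify f.
have fN (y : A) : f (- y : A) = - f y := raddfN f y.
have fi y : self_adjoint y -> f ('i%C *: y : A) = 0.
  move=> ys; apply/le_anti/andP; split.
    exact: le_trans (fle _) (upper_mean_imaginary ys).
  rewrite -oppr_le0 -fN -scalerN; apply: le_trans (fle _) _.
  by apply: upper_mean_imaginary; exact: selfadjointN.
have f1 : f (1 : A) = 1.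
  apply/le_anti; rewrite (le_trans (fle _) upper_mean1)/=.
  by rewrite -lerN2 -fN (le_trans (fle _) upper_meanN1).
have f_inv y : f (Theta 1 y) = f y.
  have le z : f (Theta 1 z) <= f z.
    have := le_trans (fle _) (upper_mean_coboundary z).
    have -> : f (Theta 1 z - z : A) = f (Theta 1 z) - f z := raddfB f _ _.
    by rewrite subr_le0.
  apply/le_anti; rewrite le -lerN2 -!fN /=.
  have -> : - Theta 1 y = Theta 1 (- y) by rewrite raddfN.
  exact: le.
have f_theta j y : f (Theta j y) = f y.
  exact: (@invariant_of_generator _ (fun y : A => f y) f_inv).
exists phi; last by rewrite phiE /= fx gauge_le_upper_mean.
split=> [|j y]; last by rewrite !phiE -(f_theta j ('i%C *: y)) linearZ f_theta.
split=> [y yp|]; rewrite phiE fi ?oppr0 ?f1//; last exact: star1.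
- rewrite ler0c -oppr_le0 -fN.
  exact: le_trans (fle _) (upper_meanN_positive yp).
- exact: yp.1.
Qed.

End OrbitSums.

Theorem theorem2p4 (R : realType) (A : cstarAlgType R) (Theta : z_action A)
    (a : A) (ha : positive a) :
  (gauge Theta a)%:E = max_value a (invariant_states Theta).
Proof.
apply/le_anti/andP; split.
  have [phi phi_inv le] := exists_invariant_state Theta ha.
  apply: (@le_trans _ _ (complex.Re (phi a))%:E); first by rewrite lee_fin.
  by apply: ereal_sup_ubound; exists phi.
apply: ge_ereal_sup => _ [phi phi_inv <-].
by rewrite lee_fin; apply: invariant_state_le_gauge => //; exact: ha.1.
Qed.
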